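(* Let $d\ge1$, $p\ge2$, $n<\infty$, and let $\{\xi(i,m)\}$ be martingale differences as in the context with $\mu_m(dp)<\infty$ for all $m=1,\dots,d$. Then $$\sup_{b\in B(d,n)}|Q_d|_p\le\gamma(d)\,p^d\prod_{m=1}^d\mu_m(dp),$$ where $\gamma(1)=\sqrt2$ and $\gamma(d+1)=\sqrt2\,(1+1/d)^d\gamma(d)$.
   Context: Martingale setting: filtration $\mathcal F(0)\subset\mathcal F(1)\subset\cdots$ with $\mathcal F(0)$ trivial; for $m=1,\dots,d$, $\xi(i,m)$ is $\mathcal F(i)$-measurable, integrable, $\mathbf E[\xi(i,m)\mid\mathcal F(i-1)]=0$. $I(d,n)=\{(i_1,\dots,i_d):1\le i_1<\dots<i_d\le n\}$, $\xi(I)=\prod_m\xi(i_m,m)$, $Q_d=\sum_{I\in I(d,n)}b(I)\xi(I)$, $B(d,n)=\{b:\sum_Ib(I)^2=1\}$. $|\eta|_p=(\mathbf E|\eta|^p)^{1/p}$, $\mu_m(p)=\sup_i|\xi(i,m)|_p$. *)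

(* Defs.v *)
From HB Require Import structures.
From mathcomp Require Import all_boot all_order all_algebra.
From mathcomp Require Import all_classical all_reals all_analysis.
Set Implicit Arguments. Unset Strict Implicit. Unset Printing Implicit Defensive.
Import Order.TTheory GRing.Theory Num.Theory.
Local Open Scope classical_set_scope.
Local Open Scope ring_scope.

Section MartDefs.
Context {dT : measure_display} {T : measurableType dT} {R : realType}.

Definition filtration (F : nat -> set (set T)) : Prop :=
  [/\ forall i, sigma_algebra setT (F i),
      forall i, F i `<=` measurable,
      forall i, F i `<=` F i.+1 &
      F 0 = [set set0; setT]].

Definition adapted_to (G : set (set T)) (X : T -> R) : Prop :=
  forall B : set R, measurable B -> G (X @^-1` B).

Definition cond_exp_zero (P : probability T R) (G : set (set T)) (X : T -> R)
  : Prop := forall A, G A -> (\int[P]_(x in A) (X x)%:E = 0)%E.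

Definition mart_diff (P : probability T R) (F : nat -> set (set T))
  (d : nat) (xi : nat -> nat -> T -> R) : Prop :=
  filtration F /\
  forall i m, (1 <= i)%N -> (1 <= m <= d)%N ->
    [/\ adapted_to (F i) (xi i m),
        P.-integrable setT (EFin \o xi i m) &
        cond_exp_zero P (F i.-1) (xi i m)].

Definition pnorm (P : probability T R) (p : R) (eta : T -> R) : \bar R :=
  Lnorm P p%:E (EFin \o eta).

Definition mu_sup (P : probability T R) (xi : nat -> nat -> T -> R)
  (m : nat) (p : R) : \bar R :=
  ereal_sup [set pnorm P p (xi i m) | i in [set i : nat | (1 <= i)%N]].

End MartDefs.

(* I(d,n): index tuples (i_1,...,i_d) with 1 <= i_1 < ... < i_d <= n,
   represented as functions s : 'I_d -> 'I_n.+1, with i_{k+1} = s k. *)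
Definition Idn (d n : nat) : {set {ffun 'I_d -> 'I_n.+1}} :=
  [set s : {ffun 'I_d -> 'I_n.+1} | [forall k : 'I_d, (0 < s k)%N] &&
           [forall k : 'I_d, forall j : 'I_d, (k < j)%N ==> (s k < s j)%N]].

Definition xiI {T : Type} {R : ringType} (d n : nat)
  (xi : nat -> nat -> T -> R) (s : {ffun 'I_d -> 'I_n.+1}) (x : T) : R :=
  \prod_(k < d) xi (s k : nat) k.+1 x.

Definition Qd {T : Type} {R : ringType} (d n : nat)
  (b : {ffun 'I_d -> 'I_n.+1} -> R) (xi : nat -> nat -> T -> R) (x : T) : R :=
  \sum_(s in Idn d n) b s * xiI xi s x.

Definition Bdn {R : ringType} (d n : nat) (b : {ffun 'I_d -> 'I_n.+1} -> R)
  : Prop := \sum_(s in Idn d n) b s ^+ 2 = 1.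

(* gamma(1) = sqrt 2, gamma(d+1) = sqrt 2 (1 + 1/d)^d gamma(d);
   gamma_aux k = gamma(k+1). *)
Fixpoint gamma_aux {R : realType} (k : nat) : R :=
  match k with
  | 0 => Num.sqrt 2
  | k'.+1 => Num.sqrt 2 * (1 + k'.+1%:R^-1) ^+ k'.+1 * gamma_aux k'
  end.
Definition gamma {R : realType} (d : nat) : R := gamma_aux d.-1.

(* Main.v *)
(** A martingale difference X orthogonal to spow p S = S |S|^(p-2) satisfies
    ||S + X||_p^2 <= ||S||_p^2 + 2 p^2 ||X||_p^2.  Indeed, convexity of |.|^p
    and the Lipschitz bound for spow p give pointwise
      |S + X|^p <= |S|^p + p X spow p S + p (p-1) (|S| + |X|)^(p-2) X^2,
    and Hoelder's inequality bounds the expectation of the last term.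

    Splitting off the largest index writes Q_{d+1} as a martingale with
    increments xi(i, d+1) Q_d^(i), where Q_d^(i) is F(i-1)-measurable and has
    coefficients b(., i).  By Hoelder with 1/p = 1/((d+1)p) + 1/q, where
    q = p (1 + 1/d) and hence d q = (d+1) p, each increment has p-norm at most
    mu_{d+1}((d+1)p) ||Q_d^(i)||_q, and induction on d applies at exponent q.
    This produces the factor sqrt 2 p (1 + 1/d)^d in the recursion. *)

Require Import Defs.
From HB Require Import structures.
From mathcomp Require Import all_boot all_order all_algebra.
From mathcomp Require Import all_classical all_reals all_analysis.
From mathcomp Require Import measurable_realfun ring lra.
Import Order.TTheory GRing.Theory Num.Theory.
Local Open Scope classical_set_scope.
Local Open Scope ring_scope.

(** * Pointwise inequalities for powers *)

(** Young's inequality for [y] and x^(r-1), with the conjugate exponents [r] and [r / (r - 1)],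
    multiplied by [r]. The second exponent makes no sense for [r = 1], where both sides equal
    [y]. *)
Lemma powR_tangent (R : realType) (r x y : R) : 1 <= r -> 0 <= x -> 0 <= y ->
  x `^ r + r * x `^ (r - 1) * (y - x) <= y `^ r.
Proof.
move=> r1 x0 y0; have r0 : 0 < r by lra.
have xr : x * x `^ (r - 1) = x `^ r by exact: mulr_powRB1.
have [->|rn1] := eqVneq r 1.
  by rewrite subrr powRr0 !powRr1//; lra.
have {rn1}r1' : 0 < r - 1 by rewrite subr_gt0 lt_neqAle eq_sym rn1.
have qE : (r / (r - 1))^-1 = (r - 1) / r by rewrite invf_div.
have pq : r^-1 + (r / (r - 1))^-1 = 1 by rewrite qE; field; lra.
have q0 : 0 < r / (r - 1) by rewrite divr_gt0.
have := conjugate_powR y0 (powR_ge0 x (r - 1)) r0 q0 pq.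
rewrite -powRrM mulrCA divff ?gt_eqF// mulr1 qE.
move=> /(ler_wpM2l (ltW r0)).
have -> : r * (y `^ r / r + x `^ r * ((r - 1) / r)) = y `^ r + (r - 1) * x `^ r.
  by field; lra.
rewrite -xr; nra.
Qed.

(** Up to the factor [p], this is the derivative of |a|^p. *)
Definition spow {R : realType} (p a : R) : R := a * `|a| `^ (p - 2).

Lemma norm_spow (R : realType) (p a : R) : 2 <= p ->
  `|spow p a| = `|a| `^ (p - 1).
Proof.
move=> p2; rewrite /spow normrM (ger0_norm (powR_ge0 _ _)).
have -> : p - 2 = (p - 1) - 1 by ring.
by rewrite mulr_powRB1//; lra.
Qed.

(** The derivative of [spow p] is (p-1)|.|^(p-2), at most (p-1) M^(p-2) on [-M, M]. Calculus is
    avoided: for nonnegative arguments the tangent bound with exponent [p - 1] applies, oddness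
    covers nonpositive ones, and across 0 the two terms are estimated separately, using 1 <= p -
    1. *)
Lemma spow_incr (R : realType) (p M x y : R) : 2 <= p ->
  y <= x -> `|x| <= M -> `|y| <= M ->
  spow p x - spow p y <= (p - 1) * M `^ (p - 2) * (x - y).
Proof.
move=> p2.
have M0 (z : R) : `|z| <= M -> 0 <= M by exact: le_trans.
have mono (z : R) : `|z| <= M -> `|z| `^ (p - 2) <= M `^ (p - 2).
  move=> zM; have Mge0 := M0 z zM.
  by apply: ge0_ler_powR => //; lra.
have pos u v : 0 <= v -> v <= u -> `|u| <= M ->
    spow p u - spow p v <= (p - 1) * M `^ (p - 2) * (u - v).
  move=> v0 vu uM; have u0 : 0 <= u by lra.
  have t : u `^ (p - 1) + (p - 1) * u `^ (p - 1 - 1) * (v - u) <= v `^ (p - 1).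
    by apply: powR_tangent => //; lra.
  have sE w : 0 <= w -> spow p w = w `^ (p - 1).
    move=> w0; rewrite /spow ger0_norm//.
    have -> : p - 2 = (p - 1) - 1 by ring.
    by rewrite mulr_powRB1//; lra.
  have pE : p - 1 - 1 = p - 2 by ring.
  rewrite !sE//; move: t; rewrite pE => t.
  have := mono _ uM; rewrite ger0_norm// => m.
  have : (p - 1) * (u - v) * (u `^ (p - 2)) <= (p - 1) * (u - v) * M `^ (p - 2).
    by apply: ler_wpM2l => //; apply: mulr_ge0; lra.
  lra.
have spowN w : spow p (- w) = - spow p w by rewrite /spow normrN mulNr.
move=> yx xM yM.
have [y0|y0] := leP 0 y; first exact: pos.
have [x0|x0] := leP x 0.
  have := pos (- y) (- x); rewrite !spowN normrN => /(_ _ _ yM).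
  by move=> h; have := h ltac:(lra) ltac:(lra); lra.
rewrite /spow; have mx := mono _ xM; have my := mono _ yM.
have K0 := powR_ge0 M (p - 2).
have h1 : x * `|x| `^ (p - 2) <= x * M `^ (p - 2) by apply: ler_wpM2l => //; lra.
have h2 : - y * `|y| `^ (p - 2) <= - y * M `^ (p - 2).
  by apply: ler_wpM2l => //; lra.
have h3 : 0 <= (p - 2) * (M `^ (p - 2) * (x - y)).
  by apply: mulr_ge0; [lra|apply: mulr_ge0 => //; lra].
lra.
Qed.

(** The tangent at |a + b|, evaluated at |a|, gives a linear term in [spow p (a + b)]; [spow_incr]
    with M = |a| + |b| replaces it by [spow p a] at the cost of the quadratic term. The sign of [b]
    decides which of [a] and [a + b] is the larger argument. *)
Lemma powR_normD_le (R : realType) (p a b : R) : 2 <= p ->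
  `|a + b| `^ p <= `|a| `^ p + p * (b * spow p a) +
    p * (p - 1) * ((`|a| + `|b|) `^ (p - 2) * b ^+ 2).
Proof.
move=> p2; set x := a + b; set K := _ `^ (p - 2).
have t : `|x| `^ p + p * `|x| `^ (p - 1) * (`|a| - `|x|) <= `|a| `^ p.
  by apply: powR_tangent => //; lra.
(* Once |x|^(p-2) is factored out, this is x a <= |x| |a|. *)
have s : `|x| `^ (p - 1) * (`|x| - `|a|) <= spow p x * b.
  have -> : p - 1 = (p - 2) + 1 by ring.
  have -> : `|x| `^ (p - 2 + 1) = `|x| * `|x| `^ (p - 2).
    have -> : p - 2 + 1 = p - 1 by ring.
    have -> : p - 2 = p - 1 - 1 by ring.
    by rewrite mulr_powRB1//; lra.
  rewrite /spow -!mulrA mulrCA [leRHS]mulrCA.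
  apply: ler_wpM2l; first exact: powR_ge0.
  have -> : b = x - a by rewrite /x; ring.
  rewrite !mulrBr -normrM -expr2 ger0_norm ?sqr_ge0//.
  by rewrite lerB// -normrM ler_norm.
have l : spow p x * b <= spow p a * b + (p - 1) * K * b ^+ 2.
  have xM : `|x| <= `|a| + `|b| by exact: ler_normD.
  have aM : `|a| <= `|a| + `|b| by rewrite lerDl.
  have [b0|b0] := leP 0 b.
    have ax : a <= x by rewrite /x; lra.
    have := spow_incr _ _ _ _ _ p2 ax xM aM; rewrite -/K => /(ler_wpM2l b0).
    by rewrite /x; lra.
  have ax : x <= a by rewrite /x; lra.
  have b0' : 0 <= - b by lra.
  have := spow_incr _ _ _ _ _ p2 ax aM xM; rewrite -/K => /(ler_wpM2l b0').
  by rewrite /x; lra.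
have p0 : 0 <= p by lra.
have := ler_wpM2l p0 (le_trans s l); lra.
Qed.

(** From 1 - 1/2 <= exp(-1/2) follows exp(1/2) <= 2; then square. *)
Lemma expR1_le4 (R : realType) : expR 1 <= 4 :> R.
Proof.
have h : 2^-1 <= expR (- 2^-1) :> R.
  by apply: le_trans (expR_ge1Dx _); lra.
have e0 := expR_gt0 (2^-1 : R).
have e1 : expR (- 2^-1) * expR (2^-1) = 1 :> R by rewrite -expRD addNr expR0.
have e2 : expR 1 = expR (2^-1) * expR (2^-1) :> R.
  by rewrite -expRD; congr expR; lra.
have : 0 <= (expR (- 2^-1) - 2^-1) * expR (2^-1) :> R.
  by apply: mulr_ge0; [rewrite subr_ge0|exact: ltW].
rewrite e2; nra.
Qed.

Lemma powR_sqrt (R : realType) (p x : R) : 0 <= x ->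
  Num.sqrt x `^ p = x `^ (p / 2).
Proof. by move=> x0; rewrite -powR12_sqrt// -powRrM mulrC. Qed.

(* For A > 0 and t = B / A <= 1 / p one has (1 + t)^(p-2) <= e <= 4, and
   Bernoulli's inequality bounds the right-hand side from below; what is left is
   4 (p - 1) <= p^2. *)
Lemma powR_smoothness (R : realType) (p A B : R) : 2 <= p -> 0 <= B ->
  p * B <= A ->
  A `^ p + p * (p - 1) * ((A + B) `^ (p - 2) * B ^+ 2) <=
  Num.sqrt (A ^+ 2 + 2 * p ^+ 2 * B ^+ 2) `^ p.
Proof.
move=> p2 B0 BA; have A0 : 0 <= A by nra.
have [A00|An0] := eqVneq A 0.
  have -> : B = 0 by nra.
  by rewrite A00 !expr0n/= !mulr0 !addr0 sqrtr0.
have {An0}A0' : 0 < A by rewrite lt_neqAle eq_sym An0.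
pose t := B / A.
have t0 : 0 <= t by rewrite divr_ge0.
have BE : B = A * t by rewrite /t; field; lra.
have tp : p * t <= 1 by move: BA; rewrite BE; nra.
have e4 : (1 + t) `^ (p - 2) <= 4.
  apply: le_trans (expR1_le4 R); apply: (@le_trans _ _ (expR t `^ (p - 2))).
    apply: ge0_ler_powR; [lra| | |exact: expR_ge1Dx].
      by rewrite nnegrE; lra.
    by rewrite nnegrE expR_ge0.
  by rewrite -expRM ler_expR; nra.
have w0 : 0 <= 1 + 2 * p ^+ 2 * t ^+ 2.
  rewrite -mulrA -exprMn; have := sqr_ge0 (p * t); lra.
have bern : 1 + p / 2 * (2 * p ^+ 2 * t ^+ 2) <= (1 + 2 * p ^+ 2 * t ^+ 2) `^ (p / 2).
  have := @powR_tangent R (p / 2) 1 _ _ ler01 w0.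
  by rewrite powR1 mulr1 [1 + _ - 1]addrC addKr; apply; lra.
have wE : A ^+ 2 + 2 * p ^+ 2 * B ^+ 2 = A ^+ 2 * (1 + 2 * p ^+ 2 * t ^+ 2).
  by rewrite BE; ring.
rewrite powR_sqrt; last by rewrite wE mulr_ge0 ?sqr_ge0.
rewrite wE powRM ?sqr_ge0//.
have A2 : (A ^+ 2) `^ (p / 2) = A `^ p.
  by rewrite -powR_mulrn// -powRrM; congr (_ `^ _); field.
have AA : A `^ p = A ^+ 2 * A `^ (p - 2).
  rewrite -powR_mulrn// -powRD; last by rewrite (gt_eqF A0') implybT.
  by rewrite subrKC.
rewrite A2.
have -> : A + B = A * (1 + t) by rewrite BE; ring.
rewrite powRM//; last by lra.
rewrite BE exprMn.
have -> : A `^ p + p * (p - 1) * (A `^ (p - 2) * (1 + t) `^ (p - 2) *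
    (A ^+ 2 * t ^+ 2)) =
    A `^ p * (1 + p * (p - 1) * t ^+ 2 * (1 + t) `^ (p - 2)).
  by rewrite AA; ring.
apply: ler_wpM2l; first exact: powR_ge0.
apply: le_trans bern; rewrite lerD2l.
have k0 : 0 <= p * (p - 1) * t ^+ 2.
  by apply: mulr_ge0; [apply: mulr_ge0; lra|exact: sqr_ge0].
apply: (le_trans (ler_wpM2l k0 e4)).
have -> : p / 2 * (2 * p ^+ 2 * t ^+ 2) = (p * t ^+ 2) * (p ^+ 2) by field.
have -> : p * (p - 1) * t ^+ 2 * 4 = (p * t ^+ 2) * ((p - 1) * 4) by ring.
apply: ler_wpM2l; first by apply: mulr_ge0; [lra|exact: sqr_ge0].
have := sqr_ge0 (p - 2); nra.
Qed.

(** * Moments, Minkowski and Hoelder *)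

(* For c >= 0 and p > 0 this says ||f||_p <= c. *)
Definition moment_le {dT : measure_display} {T : measurableType dT}
    {R : realType} (P : probability T R) (p : R) (f : T -> R) (c : R) : Prop :=
  (\int[P]_x (`|f x| `^ p)%:E <= (c `^ p)%:E)%E.

Lemma pnorm_leP (dT : measure_display) (T : measurableType dT) (R : realType)
    (P : probability T R) (p : R) (f : T -> R) (c : R) :
  0 < p -> 0 <= c -> (pnorm P p f <= c%:E)%E <-> moment_le P p f c.
Proof.
move=> p0 c0; split.
  move=> /(@gt0_ler_poweR _ p (ltW p0)).
  rewrite !in_itv/= !leey Lnorm_ge0 lee_fin c0 => /(_ isT isT).
  by rewrite poweR_Lnorm ?gt_eqF.
rewrite /moment_le => h; rewrite /pnorm unlock.
have -> : c%:E = ((c `^ p)%:E `^ p^-1)%E.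
  by rewrite poweR_EFin -powRrM mulfV ?gt_eqF// powRr1.
apply: gt0_ler_poweR => //; rewrite ?in_itv/= ?leey ?andbT.
- by rewrite invr_ge0 ltW.
- by apply: integral_ge0 => x _; rewrite lee_fin powR_ge0.
- by rewrite lee_fin powR_ge0.
Qed.

Lemma measurable_norm_powR (d : measure_display) (T : measurableType d)
    (R : realType) (p : R) (f : T -> R) :
  measurable_fun setT f -> measurable_fun setT (fun x => `|f x| `^ p).
Proof.
move=> mf.
apply: (@measurableT_comp _ _ _ _ _ _ (@powR R ^~ p)) => //.
exact: measurableT_comp.
Qed.

Lemma measurable_spow (R : realType) (p : R) :
  measurable_fun setT (@spow R p).
Proof.
by apply: measurable_funM => //; exact: measurable_norm_powR.
Qed.

Lemma moment_le_trans (dT : measure_display) (T : measurableType dT)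
    (R : realType) (P : probability T R) (p : R) (f : T -> R) (a b : R) :
  0 <= p -> 0 <= a -> a <= b -> moment_le P p f a -> moment_le P p f b.
Proof.
move=> p0 a0 ab /le_trans; apply; rewrite lee_fin.
by apply: ge0_ler_powR => //; rewrite nnegrE; lra.
Qed.

Lemma moment_leD (dT : measure_display) (T : measurableType dT) (R : realType)
    (P : probability T R) (p : R) (f g : T -> R) (a b : R) :
  1 <= p -> 0 <= a -> 0 <= b ->
  measurable_fun setT f -> measurable_fun setT g ->
  moment_le P p f a -> moment_le P p g b ->
  moment_le P p (fun x => f x + g x) (a + b).
Proof.
move=> p1 a0 b0 mf mg; have p0 : 0 < p by lra.
move=> /pnorm_leP-/(_ p0 a0) fa /pnorm_leP-/(_ p0 b0) gb.
apply/pnorm_leP => //; first by lra.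
rewrite EFinD; apply: le_trans (leeD fa gb).
exact: minkowski_EFin.
Qed.

Lemma moment_le_norm (dT : measure_display) (T : measurableType dT)
    (R : realType) (P : probability T R) (p r : R) (f : T -> R) (a : R) :
  r != 0 ->
  moment_le P p f a -> moment_le P (p / r) (fun x => `|f x| `^ r) (a `^ r).
Proof.
move=> r0; rewrite /moment_le -powRrM mulrCA mulfV// mulr1 => h.
apply: le_trans h; rewrite le_eqVlt; apply/orP; left; apply/eqP.
apply: eq_integral => x _.
by rewrite ger0_norm ?powR_ge0// -powRrM mulrCA mulfV// mulr1.
Qed.

(** Hoelder's inequality for |f|^r and |g|^s with exponents [p / r] and [p / s], whose inverses add
    up to 1. *)
Lemma hoelder_powR (dT : measure_display) (T : measurableType dT)
    (R : realType) (P : probability T R) (p r s : R) (f g : T -> R) (a b : R) :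
  0 <= r -> 0 < s -> r + s = p -> 0 <= a -> 0 <= b ->
  measurable_fun setT f -> measurable_fun setT g ->
  moment_le P p f a -> moment_le P p g b ->
  (\int[P]_x (`|f x| `^ r * `|g x| `^ s)%:E <= (a `^ r * b `^ s)%:E)%E.
Proof.
move=> r0 s0 rsp a0 b0 mf mg fa gb.
(* Here [p / r] is not a Hoelder exponent, but |f|^0 is 1 everywhere and the bound on [g] suffices.
   The case arises from r = p - 2 at p = 2. *)
have [re|rn] := eqVneq r 0.
  rewrite re powRr0 mul1r; under eq_integral do rewrite powRr0 mul1r.
  by have -> : s = p by lra.
have r0' : 0 < r by rewrite lt_neqAle eq_sym rn.
have p0 : 0 < p by lra.
have h := @hoelder _ T R P _ _ (p / r) (p / s)
  (measurable_norm_powR _ _ _ r _ mf) (measurable_norm_powR _ _ _ s _ mg).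
have {h} := h (divr_gt0 p0 r0') (divr_gt0 p0 s0).
rewrite !invf_div -mulrDl rsp divff ?gt_eqF// => /(_ erefl).
rewrite Lnorm1 => h; apply: le_trans (le_trans h _).
  rewrite le_eqVlt; apply/orP; left; apply/eqP.
  apply: eq_integral => x _ /=.
  by rewrite normrM !(ger0_norm (powR_ge0 _ _)).
rewrite [leRHS]EFinM; apply: lee_pmul; [exact: Lnorm_ge0|exact: Lnorm_ge0| |].
  rewrite -/(pnorm P (p / r) (fun x => `|f x| `^ r)).
  apply/pnorm_leP; rewrite ?divr_gt0 ?powR_ge0//.
  exact: moment_le_norm.
rewrite -/(pnorm P (p / s) (fun x => `|g x| `^ s)).
apply/pnorm_leP; rewrite ?divr_gt0 ?powR_ge0//.
by apply: moment_le_norm => //; rewrite gt_eqF.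
Qed.

(** The weights [p / q] and [p / r] add up to 1, so [hoelder_powR] applies to |f|^q and |g|^r, which
    have first moments at most a^q and b^r. *)
Lemma moment_leM (dT : measure_display) (T : measurableType dT) (R : realType)
    (P : probability T R) (p q r : R) (f g : T -> R) (a b : R) :
  0 < p -> 0 < q -> 0 < r -> p^-1 = q^-1 + r^-1 -> 0 <= a -> 0 <= b ->
  measurable_fun setT f -> measurable_fun setT g ->
  moment_le P q f a -> moment_le P r g b ->
  moment_le P p (fun x => f x * g x) (a * b).
Proof.
move=> p0 q0 r0 pqr a0 b0 mf mg fa gb.
have qn : q != 0 by rewrite gt_eqF.
have rn : r != 0 by rewrite gt_eqF.
have e1 : p / q + p / r = 1 by rewrite -mulrDr -pqr mulfV ?gt_eqF.
have := @hoelder_powR _ T R P 1 (p / q) (p / r) (fun x => `|f x| `^ q)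
  (fun x => `|g x| `^ r) (a `^ q) (b `^ r) (ltW (divr_gt0 p0 q0))
  (divr_gt0 p0 r0) e1 (powR_ge0 _ _) (powR_ge0 _ _)
  (measurable_norm_powR _ _ _ _ _ mf) (measurable_norm_powR _ _ _ _ _ mg).
have := moment_le_norm _ _ _ _ _ _ _ _ qn fa.
have := moment_le_norm _ _ _ _ _ _ _ _ rn gb.
rewrite !divff// => h1 h2 /(_ h2 h1).
rewrite -!powRrM (mulrC q) (mulrC r) !divfK// -powRM//.
apply: le_trans; rewrite le_eqVlt; apply/orP; left; apply/eqP.
apply: eq_integral => x _.
rewrite !(ger0_norm (powR_ge0 _ _)) -!powRrM (mulrC q) (mulrC r) !divfK//.
by rewrite -powRM// normrM.
Qed.

Lemma ge0_integrable_le (dT : measure_display) (T : measurableType dT)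
    (R : realType) (P : probability T R) (f : T -> R) (c : R) :
  measurable_fun setT f -> (forall x, 0 <= f x) ->
  (\int[P]_x (f x)%:E <= c%:E)%E -> P.-integrable setT (EFin \o f).
Proof.
move=> mf f0 h; apply/integrableP; split; first exact/measurable_EFinP.
under eq_integral do rewrite /= ger0_norm//.
exact: le_lt_trans h (ltry _).
Qed.

(** * Orthogonality of a martingale difference to the past *)

(** Makes the closure properties of measurable functions (sums, products, composition) available for
    adapted ones. *)
Lemma adapted_measurable (dT : measure_display) (T : measurableType dT)
    (R : realType) (G : set (set T)) (X : T -> R) : sigma_algebra setT G ->
  adapted_to G X <->
  measurable_fun (T := g_sigma_algebraType G) setT X.
Proof.
move=> sG; rewrite /adapted_to /measurable_fun.
rewrite measurable_g_measurableTypeE//; split=> h.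
  by move=> _ B mB; rewrite setTI; exact: h.
move=> B mB; rewrite -[_ @^-1` _]setTI; apply: h => //.
by case: sG => h0 hC _; rewrite -[setT](setD0); exact: hC.
Qed.

Lemma adapted_sub (dT : measure_display) (T : measurableType dT)
    (R : realType) (G : set (set T)) (X : T -> R) : G `<=` measurable ->
  adapted_to G X -> measurable_fun setT X.
Proof. by move=> sG h _ B mB; rewrite setTI; apply: sG; exact: h. Qed.

Import HBNNSimple.

(** [h] is the limit from below of simple functions of [h]. Each of them is a finite combination of
    indicators of sets in [G], over which [X] integrates to 0, and dominated convergence with bound
    |X h| passes to the limit. *)
Lemma ge0_integral_cond_exp_zero (dT : measure_display)
    (T : measurableType dT) (R : realType) (P : probability T R)
    (G : set (set T)) (X h : T -> R) :
  G `<=` measurable -> adapted_to G h -> (forall x, 0 <= h x) ->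
  P.-integrable setT (EFin \o X) -> cond_exp_zero P G X ->
  P.-integrable setT (fun x => (X x * h x)%:E) ->
  (\int[P]_x (X x * h x)%:E = 0)%E.
Proof.
move=> sG ah h0 iX X0 iXh.
(* The approximation is built on the real line, for max(y, 0), and then composed with [h]: its level
   sets become preimages under [h] of Borel sets and so belong to [G]. *)
have mpos : measurable_fun [set: R] (fun y => (Num.max y 0)%:E).
  by apply/measurable_EFinP; exact: measurable_maxr.
pose phi := nnsfun_approx measurableT mpos.
have pos0 (y : R) : setT y -> (0 <= (Num.max y 0)%:E)%E.
  by rewrite lee_fin le_max lexx orbT.
have hmax x : Num.max (h x) 0 = h x by apply/max_idPl.
have mX : measurable_fun setT X by exact/measurable_EFinP/measurable_int/iX.
have mh := adapted_sub _ _ _ _ _ sG ah.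
have step n : (\int[P]_x (X x * phi n (h x))%:E = 0)%E.
  pose s := finmap.enum_fset (fset_set (range (phi n))).
  pose A i := h @^-1` (phi n @^-1` [set s`_i]).
  have GA i : G (A i) by apply: ah; exact: measurable_sfunP.
  have iXA i : P.-integrable setT ((EFin \o X) \_ (A i)).
    apply/(integrable_mkcond _ _).1; first exact: sG.
    by apply: (integrableS measurableT _ _ iX) => //; exact: sG.
  transitivity (\int[P]_x \sum_(i < size s)
      ((s`_i)%:E * ((EFin \o X) \_ (A i)) x))%E.
    apply: eq_integral => x _; rewrite (fimfunEord (phi n)) mulr_sumr -sumEFin.
    apply: eq_bigr => i _; rewrite epatch_indic /= -!EFinM; congr EFin.
    by rewrite mulrCA.
  rewrite integral_sum//; last by move=> i; exact: integrableZl.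
  rewrite big1// => i _; rewrite integralZl// -integral_mkcond X0 ?mule0//.
have cv : (fun n => \int[P]_x (X x * phi n (h x))%:E)%E @ \oo -->
    (\int[P]_x (X x * h x)%:E)%E.
  have [] := @dominated_convergence _ T R P setT measurableT
    (fun n x => (X x * phi n (h x))%:E) (fun x => (X x * h x)%:E)
    (fun x => `|(X x * h x)%:E|%E).
  - move=> n; apply/measurable_EFinP; apply: measurable_funM => //.
    exact: measurableT_comp.
  - exact: measurable_int iXh.
  - apply/nearW => x _; under eq_fun do rewrite EFinM.
    rewrite EFinM; apply: cvgeZl => //.
    by rewrite -{2}(hmax x); exact: (cvg_nnsfun_approx measurableT mpos pos0).
  - exact: integrable_abse.
  - apply/nearW => x n _; rewrite !EFinM !abseM; apply: lee_wpmul2l => //.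
    rewrite lee_fin (ger0_norm (h0 x)) ger0_norm ?fun_ge0//.
    by rewrite -lee_fin nnsfun_approxE -{2}(hmax x); exact: le_approx.
  by [].
move: cv; under eq_fun do rewrite step.
by move=> /cvg_lim <-//; rewrite lim_cst.
Qed.

(** Split [h] into positive and negative part. Both are adapted and at most |h| in absolute value,
    so their products with [X] stay integrable. *)
Lemma integral_cond_exp_zero (dT : measure_display)
    (T : measurableType dT) (R : realType) (P : probability T R)
    (G : set (set T)) (X h : T -> R) :
  sigma_algebra setT G -> G `<=` measurable -> adapted_to G h ->
  P.-integrable setT (EFin \o X) -> cond_exp_zero P G X ->
  P.-integrable setT (fun x => (X x * h x)%:E) ->
  (\int[P]_x (X x * h x)%:E = 0)%E.
Proof.
move=> saG sG ah iX X0 iXh.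
have mX : measurable_fun setT X by exact/measurable_EFinP/measurable_int/iX.
have part (k : T -> R) : adapted_to G k -> (forall x, `|k x| <= `|h x|) ->
    P.-integrable setT (fun x => (X x * k x)%:E).
  move=> ak kh; apply: le_integrable iXh => //.
    apply/measurable_EFinP; apply: measurable_funM => //.
    exact: adapted_sub sG ak.
  by move=> x _ /=; rewrite lee_fin !normrM ler_wpM2l.
have comp (u : R -> R) : measurable_fun setT u -> adapted_to G (u \o h).
  move=> mu; apply/adapted_measurable => //.
  by apply: measurableT_comp => //; exact/adapted_measurable.
have ap : adapted_to G (fun x => Num.max (h x) 0).
  by apply: (comp (fun y => Num.max y 0)); exact: measurable_maxr.
have an : adapted_to G (fun x => Num.max (- h x) 0).
  by apply: (comp (fun y => Num.max (- y) 0)); exact: measurable_maxr.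
have mp x : 0 <= Num.max x 0 :> R by rewrite le_max lexx orbT.
have ip : P.-integrable setT (fun x => (X x * Num.max (h x) 0)%:E).
  apply: part => // x; rewrite ger0_norm// ge_max normr_ge0 andbT.
  exact: ler_norm.
have in' : P.-integrable setT (fun x => (X x * Num.max (- h x) 0)%:E).
  apply: part => // x; rewrite ger0_norm// ge_max normr_ge0 andbT.
  by rewrite -normrN ler_norm.
transitivity (\int[P]_x ((X x * Num.max (h x) 0)%:E -
    (X x * Num.max (- h x) 0)%:E))%E.
  apply: eq_integral => x _; rewrite -EFinB -mulrBr; congr (_ * _)%:E.
  have /orP[hx|hx] := le_total 0 (h x).
    by rewrite (max_idPl hx) (max_idPr _) ?subr0// oppr_le0.
  by rewrite (max_idPr hx) (max_idPl _) ?sub0r ?opprK// oppr_ge0.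
rewrite integralB_EFin// !(ge0_integral_cond_exp_zero _ _ _ _ G)//.
by rewrite sube0.
Qed.

(** * One martingale step in L^p *)

(** The absolute value is |S|^(p-1) |X|, to which Hoelder applies with powers [p - 1] and 1. *)
Lemma integrable_mul_spow (dT : measure_display) (T : measurableType dT)
    (R : realType) (P : probability T R) (p : R) (S X : T -> R) (A B : R) :
  2 <= p -> 0 <= A -> 0 <= B ->
  measurable_fun setT S -> measurable_fun setT X ->
  moment_le P p S A -> moment_le P p X B ->
  P.-integrable setT (fun x => (X x * spow p (S x))%:E).
Proof.
move=> p2 A0 B0 mS mX SA XB.
have mXS : measurable_fun setT (fun x => X x * spow p (S x)).
  apply: measurable_funM => //; apply: measurableT_comp => //.
  exact: measurable_spow.
have p1 : 0 <= p - 1 by lra.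
have e : p - 1 + 1 = p by ring.
have h := hoelder_powR _ _ _ _ _ _ _ _ _ _ _ p1 ltr01 e A0 B0 mS mX SA XB.
apply: (@le_integrable _ _ _ _ _ measurableT _
    (EFin \o (fun x => `|S x| `^ (p - 1) * `|X x| `^ 1))).
- exact/measurable_EFinP.
- move=> x _ /=; rewrite lee_fin normrM norm_spow// powRr1//.
  by rewrite [leRHS]normrM (ger0_norm (powR_ge0 _ _)) normr_id mulrC.
- apply: ge0_integrable_le h; last by move=> x; rewrite mulr_ge0 ?powR_ge0.
  by apply: measurable_funM; exact: measurable_norm_powR.
Qed.

(** For p B < A, integrate [powR_normD_le]: the linear term vanishes by orthogonality, the last one
    is bounded by Hoelder with powers [p - 2] and 2, and [powR_smoothness] absorbs the sum into the
    square root. *)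
Lemma moment_leD_orthogonal (dT : measure_display) (T : measurableType dT)
    (R : realType) (P : probability T R) (p : R) (S X : T -> R) (A B : R) :
  2 <= p -> 0 <= A -> 0 <= B ->
  measurable_fun setT S -> measurable_fun setT X ->
  moment_le P p S A -> moment_le P p X B ->
  (\int[P]_x (X x * spow p (S x))%:E = 0)%E ->
  moment_le P p (fun x => S x + X x)
    (Num.sqrt (A ^+ 2 + 2 * p ^+ 2 * B ^+ 2)).
Proof.
move=> p2 A0 B0 mS mX SA XB SX0; have p1 : 1 <= p by lra.
(* If A <= p B, Minkowski's inequality already suffices. *)
have [ApB|pBA] := leP A (p * B).
  apply: (@moment_le_trans _ _ _ _ _ _ (A + B)); [lra|lra| |exact: moment_leD].
  rewrite -(@ler_sqr _ (A + B)) ?nnegrE ?sqrtr_ge0//; last by lra.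
  (* Now (A + B)^2 <= A^2 + (2p + 1) B^2, and 2p + 1 <= 2p^2 for p >= 2. *)
  have B2 := sqr_ge0 B; have AB := ler_wpM2r B0 ApB.
  have h2 : 0 <= (p - 2) * (p * B ^+ 2) by rewrite !mulr_ge0//; lra.
  have h1 : 0 <= (p - 2) * B ^+ 2 by rewrite !mulr_ge0//; lra.
  have h3 : 0 <= p ^+ 2 * B ^+ 2 by rewrite mulr_ge0 ?sqr_ge0.
  rewrite sqr_sqrtr; first nra.
  by rewrite addr_ge0 ?sqr_ge0//; lra.
have mN : measurable_fun setT (fun x => `|S x| + `|X x|).
  by apply: measurable_funD; exact: measurableT_comp.
have nS : moment_le P p (fun x => `|S x|) A.
  by rewrite /moment_le; under eq_integral do rewrite normr_id.
have nX : moment_le P p (fun x => `|X x|) B.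
  by rewrite /moment_le; under eq_integral do rewrite normr_id.
have MSX : moment_le P p (fun x => `|S x| + `|X x|) (A + B).
  by apply: moment_leD => //; exact: measurableT_comp.
have AB0 : 0 <= A + B by lra.
have p20 : 0 <= p - 2 by lra.
have e : p - 2 + 2 = p by ring.
have h2 : 0 < 2 :> R by lra.
have H := hoelder_powR _ _ _ _ _ _ _ _ _ _ _ p20 h2 e AB0 B0 mN mX MSX XB.
(* The three terms of the pointwise bound; [c3] will bound the integral of the third. *)
pose f1 x := `|S x| `^ p.
pose f2 x := p * (X x * spow p (S x)).
pose f3 x := p * (p - 1) * ((`|S x| + `|X x|) `^ (p - 2) * X x ^+ 2).
pose c3 := p * (p - 1) * ((A + B) `^ (p - 2) * B ^+ 2).
have pp : 0 <= p * (p - 1) by rewrite mulr_ge0//; lra.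
have i1 : P.-integrable setT (EFin \o f1).
  apply: ge0_integrable_le SA; first exact: measurable_norm_powR.
  by move=> x; exact: powR_ge0.
have i2 : P.-integrable setT (EFin \o f2).
  apply: (@integrableZl _ _ _ _ _ measurableT p
    (fun x => (X x * spow p (S x))%:E)).
  exact: integrable_mul_spow SA XB.
have m3 : measurable_fun setT f3.
  apply: measurable_funM => //; apply: measurable_funM.
    exact: (@measurableT_comp _ _ _ _ _ _ (@powR R ^~ (p - 2))).
  exact: measurable_funX.
have f30 x : 0 <= f3 x.
  by apply: mulr_ge0 => //; apply: mulr_ge0; [exact: powR_ge0|exact: sqr_ge0].
have I3 : (\int[P]_x (f3 x)%:E <= c3%:E)%E.
  rewrite /f3; under eq_integral do rewrite EFinM.
  rewrite ge0_integralZl_EFin//; last 2 first.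
  - by move=> x _; rewrite lee_fin mulr_ge0 ?powR_ge0 ?sqr_ge0.
  - apply/measurable_EFinP; apply: measurable_funM.
      exact: (@measurableT_comp _ _ _ _ _ _ (@powR R ^~ (p - 2))).
    exact: measurable_funX.
  rewrite /c3 [leRHS]EFinM; apply: lee_wpmul2l; first by rewrite lee_fin.
  move: H; rewrite powR_mulrn//; apply: le_trans.
  rewrite le_eqVlt; apply/orP; left; apply/eqP; apply: eq_integral => x _.
  rewrite powR_mulrn// real_normK ?num_real//.
  by rewrite (ger0_norm (addr_ge0 (normr_ge0 _) (normr_ge0 _))).
have i3 : P.-integrable setT (EFin \o f3) by exact: ge0_integrable_le I3.
apply: (@le_trans _ _ (\int[P]_x ((f1 x)%:E + ((f2 x)%:E + (f3 x)%:E)))%E).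
  apply: ge0_le_integral => //.
  - by apply/measurable_EFinP/measurable_norm_powR; exact: measurable_funD.
  - apply/measurable_EFinP; apply: measurable_funD.
      exact: measurable_norm_powR.
    by apply: measurable_funD => //; exact/measurable_EFinP/measurable_int/i2.
  - by move=> x _; rewrite -!EFinD lee_fin addrA; exact: powR_normD_le.
rewrite integralD//; last exact: integrableD.
rewrite integralD//.
have -> : (\int[P]_x (f2 x)%:E = 0)%E.
  rewrite /f2; under eq_integral do rewrite EFinM.
  rewrite integralZl ?SX0 ?mule0//; exact: integrable_mul_spow SA XB.
rewrite add0e; apply: (@le_trans _ _ ((A `^ p)%:E + c3%:E)%E).
  exact: leeD.
by rewrite -EFinD lee_fin; apply: powR_smoothness => //; exact: ltW.
Qed.

(** * Splitting off the largest index *)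

(** Entries keep the type ['I_n.+1], so [k] can vary in an induction while the coefficient function
    stays fixed. *)
Definition Idk (d n k : nat) : {set {ffun 'I_d -> 'I_n.+1}} :=
  [set s in Idn d n | [forall j : 'I_d, (s j <= k)%N]].

Lemma IdkP (d n k : nat) (s : {ffun 'I_d -> 'I_n.+1}) :
  reflect ((forall j, 0 < s j <= k)%N /\
           (forall i j : 'I_d, (i < j)%N -> (s i < s j)%N))
    (s \in Idk d n k).
Proof.
rewrite !inE; apply: (iffP idP).
  move=> /andP[/andP[/forallP s0 /forallP si] /forallP sk]; split.
    by move=> j; rewrite s0 sk.
  by move=> i j; move: (si i) => /forallP/(_ j)/implyP.
move=> [s0k si]; apply/andP; split; [apply/andP; split|]; apply/forallP => j.
- by case/andP: (s0k j).
- by apply/forallP => i; apply/implyP; exact: si.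
- by case/andP: (s0k j).
Qed.

Lemma Idk_full (d n : nat) : Idk d n n = Idn d n.
Proof.
apply/setP => s; rewrite inE andb_idr// => _; apply/forallP => j.
by rewrite -ltnS.
Qed.

(* Appends i as the last entry of the tuple s. *)
Definition ext_ffun (d n : nat) (i : 'I_n.+1) (s : {ffun 'I_d -> 'I_n.+1}) :
    {ffun 'I_d.+1 -> 'I_n.+1} :=
  [ffun j => if unlift ord_max j is Some j' then s j' else i].

Lemma ext_ffun_lift (d n : nat) (i : 'I_n.+1) (s : {ffun 'I_d -> 'I_n.+1})
    (j : 'I_d) : ext_ffun d n i s (lift ord_max j) = s j.
Proof. by rewrite ffunE liftK. Qed.

Lemma ext_ffun_max (d n : nat) (i : 'I_n.+1) (s : {ffun 'I_d -> 'I_n.+1}) :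
  ext_ffun d n i s ord_max = i.
Proof. by rewrite ffunE unlift_none. Qed.

Lemma forall_ord_recr (d : nat) (Q : 'I_d.+1 -> Prop) :
  Q ord_max -> (forall j : 'I_d, Q (lift ord_max j)) -> forall j, Q j.
Proof. by move=> Qm Ql j; case: (unliftP ord_max j) => [j' ->|->]. Qed.

(** Either the last entry, which is the largest, is at most [k], and then so are all entries; or it
    is [k.+1], and deleting it is a bijection onto [Idk d n k]. *)
Lemma big_Idk_recr (V : nmodType) (d n k : nat)
    (f : {ffun 'I_d.+1 -> 'I_n.+1} -> V) : (k < n)%N ->
  \sum_(s in Idk d.+1 n k.+1) f s =
  \sum_(s in Idk d.+1 n k) f s +
  \sum_(s in Idk d n k) f (ext_ffun d n (inord k.+1) s).
Proof.
(* [k < n] ensures that [inord k.+1] really has the value [k.+1]. *)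
move=> kn; have kE : (inord k.+1 : 'I_n.+1) = k.+1 :> nat by rewrite inordK.
rewrite (bigID (fun s : {ffun 'I_d.+1 -> 'I_n.+1} =>
  s ord_max == inord k.+1)) /= addrC; congr (_ + _).
  apply: eq_bigl => s; apply/andP/IdkP.
    move=> [/IdkP[s0k si] sk]; split=> // j.
    have smk : (s ord_max <= k)%N.
      case/andP: (s0k ord_max) => _; rewrite leq_eqVlt ltnS => /orP[/eqP e|//].
      by case/eqP: sk; apply: val_inj; rewrite /= kE.
    case/andP: (s0k j) => -> _ /=; move: j; apply: forall_ord_recr => // j.
    apply: leq_trans smk; apply: ltnW; apply: si.
    by rewrite lift_max.
  move=> [s0k si]; split.
    apply/IdkP; split=> // j; case/andP: (s0k j) => -> /= sk.
    exact: leqW.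
  apply/eqP => e; case/andP: (s0k ord_max) => _.
  by rewrite e kE ltnn.
rewrite (reindex_onto (ext_ffun d n (inord k.+1))
  (fun s => [ffun j => s (lift ord_max j)])) /=; last first.
  move=> s /andP[_ /eqP sm]; apply/ffunP; apply: forall_ord_recr => [|j].
    by rewrite ext_ffun_max.
  by rewrite ext_ffun_lift ffunE.
apply: eq_bigl => s; rewrite ext_ffun_max eqxx andbT.
have -> : [ffun j => ext_ffun d n (inord k.+1) s (lift ord_max j)] = s.
  by apply/ffunP => j; rewrite ffunE ext_ffun_lift.
rewrite eqxx andbT; apply/IdkP/IdkP => -[s0k si]; split.
- move=> j; move: (s0k (lift ord_max j)); rewrite ext_ffun_lift.
  case/andP=> -> _ /=; have := si (lift ord_max j) ord_max.
  by rewrite ext_ffun_lift ext_ffun_max kE ltnS; apply; rewrite lift_max.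
- move=> i j ij; have := si (lift ord_max i) (lift ord_max j).
  by rewrite !ext_ffun_lift; apply; rewrite !lift_max.
- apply: forall_ord_recr => [|j]; first by rewrite ext_ffun_max kE leqnn.
  by rewrite ext_ffun_lift; case/andP: (s0k j) => -> /= /leqW.
- apply: forall_ord_recr => [|i]; apply: forall_ord_recr => [|j].
  + by rewrite ltnn.
  + by rewrite lift_max => /ltn_trans/(_ (ltn_ord j)); rewrite ltnn.
  + move=> _; rewrite ext_ffun_lift ext_ffun_max kE ltnS.
    by case/andP: (s0k i).
  + by rewrite !lift_max !ext_ffun_lift; exact: si.
Qed.

Lemma Idk0 (d n : nat) : Idk d.+1 n 0 = finset.set0.
Proof.
apply/setP => s; rewrite finset.in_set0; apply/negbTE/negP => /IdkP[s0 _].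
by have := s0 ord0; rewrite leqn0 lt0n; case: eqP.
Qed.

(** The empty tuple is the only one, so Q_0 is a constant; this starts the induction on [d]. *)
Lemma big_Idk_0 (V : nmodType) (n k : nat)
    (f : {ffun 'I_0 -> 'I_n.+1} -> V) :
  \sum_(s in Idk 0 n k) f s = f [ffun=> ord0].
Proof.
rewrite (big_pred1 [ffun=> ord0])// => s.
have -> : s = [ffun=> ord0] by apply/ffunP; case.
rewrite /= eqxx; apply/IdkP; split; by case.
Qed.

(** * Partial sums, their increments and their measurability *)

(* The part of Q_d carried by the tuples whose largest index is at most k. *)
Definition Qk {T : Type} {R : nzRingType} (d n k : nat)
  (b : {ffun 'I_d -> 'I_n.+1} -> R) (xi : nat -> nat -> T -> R) (x : T) : R :=
  \sum_(s in Idk d n k) b s * xiI xi s x.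

Lemma xiI_ext (T : Type) (R : comNzRingType) (d n : nat)
    (xi : nat -> nat -> T -> R) (i : 'I_n.+1) (s : {ffun 'I_d -> 'I_n.+1})
    (x : T) : xiI xi (ext_ffun d n i s) x = xi i d.+1 x * xiI xi s x.
Proof.
rewrite /xiI big_ord_recr/= ext_ffun_max mulrC; congr (_ * _).
apply: eq_bigr => j _.
have -> : widen_ord (leqnSn d) j = lift ord_max j.
  by apply: val_inj; rewrite [RHS]lift_max.
by rewrite ext_ffun_lift.
Qed.

Lemma Qk_recr (T : Type) (R : comNzRingType) (d n k : nat)
    (b : {ffun 'I_d.+1 -> 'I_n.+1} -> R) (xi : nat -> nat -> T -> R) (x : T) :
  (k < n)%N ->
  Qk d.+1 n k.+1 b xi x = Qk d.+1 n k b xi x +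
    xi k.+1 d.+1 x * Qk d n k (fun s => b (ext_ffun d n (inord k.+1) s)) xi x.
Proof.
move=> kn; rewrite /Qk big_Idk_recr//; congr (_ + _).
rewrite mulr_sumr; apply: eq_bigr => s _.
by rewrite xiI_ext inordK// mulrCA.
Qed.

Lemma filtration_mono (dT : measure_display) (T : measurableType dT)
    (F : nat -> set (set T)) (i j : nat) :
  filtration F -> (i <= j)%N -> F i `<=` F j.
Proof.
move=> [_ _ F1 _]; elim: j => [|j IH]; first by rewrite leqn0 => /eqP ->.
rewrite leq_eqVlt ltnS => /orP[/eqP ->//|/IH Fij].
exact: subset_trans (F1 j).
Qed.

(** Every factor has first index at most [k], hence is F(k)-measurable by monotonicity of the
    filtration. [D] is kept apart from [d] because the number of factors varies while the family of
    differences is fixed. *)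
Lemma Qk_adapted (dT : measure_display) (T : measurableType dT)
    (R : realType) (P : probability T R) (F : nat -> set (set T))
    (xi : nat -> nat -> T -> R) (D d n k : nat)
    (b : {ffun 'I_d -> 'I_n.+1} -> R) :
  mart_diff P F D xi -> (d <= D)%N -> adapted_to (F k) (Qk d n k b xi).
Proof.
move=> [fF xiP] dD; have [sF _ _ _] := fF.
apply/adapted_measurable; first exact: sF.
rewrite /Qk; under eq_fun do rewrite big_mkcond/=.
apply: measurable_sum => s; case: (boolP (s \in Idk d n k)) => [/IdkP[s0k _]|_]; last first.
  exact: measurable_cst.
apply: measurable_funM; first exact: measurable_cst.
apply: measurable_prod => j _.
apply/adapted_measurable; first exact: sF.
have /andP[s0 sk] := s0k j.
have [|ax _ _] := xiP (s j) j.+1 s0; first by rewrite (leq_trans (ltn_ord j)).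
by move=> B mB; apply: (filtration_mono _ _ _ _ _ fF sk); exact: ax.
Qed.

(** * Induction on the largest index, then on [d] *)

(** Each step of the martingale adds 2 p^2 times the square of the increment bound to the square of
    the current bound. These squares are proportional to sums of b^2, which add up exactly, so the
    constant does not depend on [k] or [n]. *)
Lemma Qk_moment_martingale (dT : measure_display) (T : measurableType dT)
    (R : realType) (P : probability T R) (F : nat -> set (set T))
    (xi : nat -> nat -> T -> R) (D d n : nat) (p M : R) :
  2 <= p -> 0 <= M -> mart_diff P F D xi -> (d < D)%N ->
  (forall k (b : {ffun 'I_d -> 'I_n.+1} -> R), (k < n)%N ->
    moment_le P p (fun x => xi k.+1 d.+1 x * Qk d n k b xi x)
      (M * Num.sqrt (\sum_(s in Idk d n k) b s ^+ 2))) ->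
  forall k (b : {ffun 'I_d.+1 -> 'I_n.+1} -> R), (k <= n)%N ->
    moment_le P p (Qk d.+1 n k b xi)
      (Num.sqrt 2 * p * M * Num.sqrt (\sum_(s in Idk d.+1 n k) b s ^+ 2)).
Proof.
move=> p2 M0 mxi dD HX; have [fF xiP] := mxi; have [sF mF _ _] := fF.
have mQ e j (c : {ffun 'I_e -> 'I_n.+1} -> R) : (e <= D)%N ->
    measurable_fun setT (Qk e n j c xi).
  by move=> eD; apply: (adapted_sub _ _ _ _ _ (mF j)); exact: Qk_adapted mxi eD.
have sum0 e j (c : {ffun 'I_e -> 'I_n.+1} -> R) :
    0 <= \sum_(s in Idk e n j) c s ^+ 2.
  by apply: sumr_ge0 => s _; exact: sqr_ge0.
elim=> [|k IH] b kn.
  rewrite Idk0 big_set0 sqrtr0 mulr0 /moment_le /Qk.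
  under eq_integral do rewrite Idk0 big_set0 normr0 powR0 ?gt_eqF ?(lt_le_trans _ p2)//.
  by rewrite integral0 lee_fin powR_ge0.
set b' := fun s => b (ext_ffun d n (inord k.+1) s).
have {IH} IHk := IH b (ltnW kn).
have {HX} HXk := HX k b' kn.
have [axi ixi cxi] := xiP k.+1 d.+1 isT dD.
have mX : measurable_fun setT (fun x => xi k.+1 d.+1 x * Qk d n k b' xi x).
  apply: measurable_funM; last exact: mQ (ltnW dD).
  exact: (adapted_sub _ _ _ _ _ (mF k.+1)).
have A0 : 0 <= Num.sqrt 2 * p * M * Num.sqrt (\sum_(s in Idk d.+1 n k) b s ^+ 2).
  by rewrite !mulr_ge0 ?sqrtr_ge0//; lra.
have B0 : 0 <= M * Num.sqrt (\sum_(s in Idk d n k) b' s ^+ 2).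
  by rewrite mulr_ge0 ?sqrtr_ge0.
have iXS := integrable_mul_spow _ _ _ _ _ _ _ _ _ p2 A0 B0 (mQ _ _ _ dD) mX IHk HXk.
(* Regrouped, the product is [xi k.+1 d.+1] times an F(k)-measurable function. *)
have orth : (\int[P]_x ((xi k.+1 d.+1 x * Qk d n k b' xi x) *
    spow p (Qk d.+1 n k b xi x))%:E = 0)%E.
  under eq_integral do rewrite -mulrA.
  apply: (integral_cond_exp_zero _ _ _ _ (F k)) => //.
    apply/adapted_measurable => //; apply: measurable_funM.
      by apply/adapted_measurable => //; exact: Qk_adapted mxi (ltnW dD).
    apply: measurableT_comp; first exact: measurable_spow.
    by apply/adapted_measurable => //; exact: Qk_adapted mxi dD.
  by under eq_fun do rewrite mulrA.
have := moment_leD_orthogonal _ _ _ _ _ _ _ _ _ p2 A0 B0 (mQ _ _ _ dD) mX IHk HXk orth.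
rewrite big_Idk_recr// -/b'.
rewrite !exprMn !sqr_sqrtr//.
set w1 := \sum_(s in Idk d.+1 n k) _; set w2 := \sum_(s in Idk d n k) _.
have -> : 2 * p ^+ 2 * M ^+ 2 * w1 + 2 * p ^+ 2 * (M ^+ 2 * w2) =
    2 * (p * M) ^+ 2 * (w1 + w2) by ring.
have pM : 0 <= p * M by rewrite mulr_ge0//; lra.
have -> : Num.sqrt (2 * (p * M) ^+ 2 * (w1 + w2)) =
    Num.sqrt 2 * p * M * Num.sqrt (w1 + w2).
  rewrite (sqrtrM _ (mulr_ge0 _ (sqr_ge0 _)))// (sqrtrM _ (ler0n _ 2)).
  by rewrite sqrtr_sqr (ger0_norm pM) mulrA.
by under [X in moment_le _ _ X _]eq_fun do rewrite -Qk_recr//.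
Qed.

Lemma gamma_aux_ge0 (R : realType) (k : nat) : 0 <= gamma_aux k :> R.
Proof.
elim: k => [|k IH] /=; first exact: sqrtr_ge0.
by rewrite !mulr_ge0 ?sqrtr_ge0// exprn_ge0// addr_ge0.
Qed.

(** [r] stays fixed and [q] varies with [d]: lowering [d] raises [q] so that [d.+1%:R * q = r]
    persists, and the same bounds [u] serve at every level. *)
Lemma Qk_moment (dT : measure_display) (T : measurableType dT)
    (R : realType) (P : probability T R) (F : nat -> set (set T))
    (xi : nat -> nat -> T -> R) (D d n : nat) (q r : R) (u : nat -> R) :
  mart_diff P F D xi -> (d < D)%N -> 2 <= q -> d.+1%:R * q = r ->
  (forall m, 0 <= u m) ->
  (forall i m, (1 <= i)%N -> (1 <= m <= D)%N -> moment_le P r (xi i m) (u m)) ->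
  forall k (b : {ffun 'I_d.+1 -> 'I_n.+1} -> R), (k <= n)%N ->
    moment_le P q (Qk d.+1 n k b xi)
      (gamma d.+1 * q ^+ d.+1 * (\prod_(m < d.+1) u m.+1) *
       Num.sqrt (\sum_(s in Idk d.+1 n k) b s ^+ 2)).
Proof.
move=> mxi + + + u0 xiu; elim: d q => [|d IH] q dD q2 qr k b kn.
  have M0 := u0 1.
  have := @Qk_moment_martingale _ T R P F xi D 0 n q (u 1) q2 M0 mxi dD.
  rewrite /gamma /= expr1 big_ord1; apply=> // {kn}k {}b kn.
  (* With no earlier factor, the increment is xi(k+1, 1) times one coefficient, and the square root
     is its absolute value. *)
  rewrite !big_Idk_0 sqrtr_sqr.
  have := xiu k.+1 1 isT; rewrite dD => /(_ isT).
  rewrite -qr mul1r /moment_le powRM// => h.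
  have q0 : 0 <= q by lra.
  under eq_integral.
    move=> x _; rewrite /Qk big_Idk_0 /xiI big_ord0 mulr1 normrM powRM// EFinM muleC.
    over.
  have mxi1 : measurable_fun setT (xi k.+1 1).
    have [fF xiP] := mxi; have [_ mF _ _] := fF.
    by have [ax _ _] := xiP k.+1 1 isT dD; exact: (adapted_sub _ _ _ _ _ (mF k.+1)).
  rewrite ge0_integralZl_EFin ?powR_ge0//; last first.
    by apply/measurable_EFinP; exact: measurable_norm_powR.
  rewrite [leRHS]EFinM [leRHS]muleC; apply: lee_wpmul2l; last exact: h.
  by rewrite lee_fin powR_ge0.
have d1 : 0 < d.+1%:R :> R by rewrite ltr0n.
have d2 : 0 < d.+2%:R :> R by rewrite ltr0n.
(* The exponent that the induction hypothesis requires for this [r]; since r = (d+2) q, it also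
   satisfies 1/q = 1/r + 1/q'. *)
pose q' := r / d.+1%:R.
have q'r : d.+1%:R * q' = r by rewrite /q' mulrCA mulfV ?gt_eqF// mulr1.
have q'E : q' = q * (1 + d.+1%:R^-1).
  rewrite /q' -qr -(natr1 d.+1); field; lra.
have iv : 0 < d.+1%:R^-1 :> R by rewrite invr_gt0.
have q0 : 0 < q by lra.
have q'q : q <= q' by rewrite q'E mulrDr mulr1 lerDl mulr_ge0// ltW.
have q'2 : 2 <= q' by lra.
have q'0 : 0 < q' by lra.
have r0 : 0 < r by rewrite -qr mulr_gt0.
have invE : q^-1 = r^-1 + q'^-1.
  rewrite /q' -qr -(natr1 d.+1); field.
  by apply/andP; split; lra.
pose M := u d.+2 * (gamma d.+1 * q' ^+ d.+1 * (\prod_(m < d.+1) u m.+1)).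
have pr0 : 0 <= \prod_(m < d.+1) u m.+1 by apply: prodr_ge0.
have K0 : 0 <= gamma d.+1 * q' ^+ d.+1 * (\prod_(m < d.+1) u m.+1).
  by rewrite !mulr_ge0// ?exprn_ge0//; [exact: gamma_aux_ge0|lra].
have M0 : 0 <= M by rewrite mulr_ge0.
have := @Qk_moment_martingale _ T R P F xi D d.+1 n q M q2 M0 mxi dD.
(* Expanding q'^(d+1) = q^(d+1) (1 + 1/(d+1))^(d+1) produces exactly the recursion of [gamma]. *)
have -> : Num.sqrt 2 * q * M =
    gamma d.+2 * q ^+ d.+2 * (\prod_(m < d.+2) u m.+1).
  rewrite /M q'E /gamma /= [in RHS]big_ord_recr/= (exprS q) exprMn.
  set a := (1 + _) ^+ _; set c := q ^+ _; set e := gamma_aux _.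
  set w := \prod_(_ < _) _. move: a c e w => a c e w.
  by ring.
apply=> // {kn}k {}b kn.
rewrite /M -mulrA; have [fF xiP] := mxi; have [_ mF _ _] := fF.
apply: (moment_leM _ _ _ _ _ _ _ _ _ _ _ q0 r0 q'0 invE) => //.
- by rewrite mulr_ge0 ?sqrtr_ge0.
- have [ax _ _] := xiP k.+1 d.+2 isT dD.
  exact: (adapted_sub _ _ _ _ _ (mF k.+1)).
- apply: (adapted_sub _ _ _ _ _ (mF k)).
  exact: Qk_adapted mxi (ltnW dD).
- exact: xiu.
- by apply: IH => //; exact: ltnW.
Qed.

Theorem theorem6 (dT : measure_display) (T : measurableType dT) (R : realType)
  (P : probability T R) (F : nat -> set (set T)) (xi : nat -> nat -> T -> R)
  (d n : nat) (p : R) :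
  (1 <= d)%N -> 2 <= p ->
  mart_diff P F d xi ->
  (forall m, (1 <= m <= d)%N -> (mu_sup P xi m (d%:R * p) < +oo)%E) ->
  forall b : {ffun 'I_d -> 'I_n.+1} -> R, Bdn b ->
    (pnorm P p (Qd b xi)
     <= (gamma d * p ^+ d)%:E *
        \prod_(m < d) mu_sup P xi m.+1 (d%:R * p))%E.
Proof.
case: d => // d _ p2 mxi mufin b Bb.
have p0 : 0 < p by lra.
have r0 : 0 < d.+1%:R * p by rewrite mulr_gt0.
set r := d.+1%:R * p in mufin r0 *.
have le_mu i m : (1 <= i)%N -> (pnorm P r (xi i m) <= mu_sup P xi m r)%E.
  by move=> i1; apply: ereal_sup_ubound; exists i.
have mu0 m : (0 <= mu_sup P xi m r)%E.
  by apply: le_trans (le_mu 1 m isT); exact: Lnorm_ge0.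
(* Outside 1 <= m <= d+1 the supremum may be infinite and [fine] then returns 0; [u m] is identified
   with it only inside that range. *)
pose u m := fine (mu_sup P xi m r).
have u0 m : 0 <= u m by exact: fine_ge0.
have muE m : (1 <= m <= d.+1)%N -> mu_sup P xi m r = (u m)%:E.
  by move=> m1; rewrite fineK// ge0_fin_numE//; exact: mufin.
have xiu i m : (1 <= i)%N -> (1 <= m <= d.+1)%N ->
    moment_le P r (xi i m) (u m).
  by move=> i1 m1; apply/pnorm_leP => //; rewrite -muE//; exact: le_mu.
have := @Qk_moment _ T R P F xi d.+1 d n p r u mxi (ltnSn d) p2 erefl u0 xiu n b (leqnn n).
rewrite Idk_full Bb sqrtr1 mulr1 => H.
have -> : (\prod_(m < d.+1) mu_sup P xi m.+1 r)%E = (\prod_(m < d.+1) u m.+1)%:E.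
  rewrite -prodEFin; apply: eq_bigr => m _; rewrite muE//.
  by rewrite ltn_ord.
have K0 : 0 <= gamma d.+1 * p ^+ d.+1 * (\prod_(m < d.+1) u m.+1).
  by rewrite !mulr_ge0 ?prodr_ge0 ?exprn_ge0 ?gamma_aux_ge0//; exact: ltW.
rewrite -EFinM.
apply: (pnorm_leP _ _ _ _ _ _ _ p0 K0).2.
by move: H; rewrite /Qk Idk_full.
Qed.
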